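(* Let $m\ge 1$. Let $S_m$ be the symmetric group on $\{1,\dots,m\}$, let $T$ be the set of adjacent transpositions in $S_m$, and let $a$ and $b$ be diametric vertices of the hypercube $Q_m$. Then $S(Q_m,a,b)\cong \mathrm{Cay}(S_m;T)$.
   Context: For a graph $G$ with distinct vertices $a,b$, a shortest $a,b$-path is a path between $a$ and $b$ of length $d_G(a,b)$. The shortest path graph $S(G,a,b)$ is the graph whose vertices are the shortest $a,b$-paths in $G$, two of them being adjacent if and only if the corresponding paths differ in exactly one vertex. The hypercube $Q_m$ has as vertices the binary sequences of length $m$, two being adjacent if and only if they differ in exactly one position; diametric vertices are two vertices at distance $m$, i.e. differing in every position. The group operation of $S_m$ is composition, $(\sigma\tau)(j)=\sigma(\tau(j))$. An adjacent transposition is a permutation $\tau_i$, $1\le i\le m-1$, with $\tau_i(i)=i+1$, $\tau_i(i+1)=i$, and $\tau_i(k)=k$ for $k\notin\{i,i+1\}$. For a group $\Gamma$ and a generating set $S$ of $\Gamma$ that does not contain the identity and is closed under inverses, $\mathrm{Cay}(\Gamma;S)$ is the graph whose vertices are the elements of $\Gamma$, with an edge between $x$ and $y$ if and only if $x\cdot s=y$ for some $s\in S$. *)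

(* Defs.v *)
From HB Require Import structures.
From mathcomp Require Import all_boot all_fingroup.

Set Implicit Arguments.
Unset Strict Implicit.
Unset Printing Implicit Defensive.

Record sgraph := SGraph {
  vertex :> finType;
  edge : rel vertex;
  edge_sym : symmetric edge;
  edge_irrefl : irreflexive edge
}.

Definition isomorphic (G H : sgraph) : Prop :=
  exists2 f : G -> H, bijective f & forall x y, edge (f x) (f y) = edge x y.

Section ShortestPathGraph.

Variables (G : sgraph) (a b : G).

(* [p] lists the vertices of the path after the initial vertex [a], so the
   length of the path (its number of edges) is [size p]. *)
Definition gpath (p : seq G) : bool :=
  [&& path (@edge G) a p, last a p == b & uniq (a :: p)].

(* A path has fewer than [#|G|] edges; [gdist] is [#|G|] if no path joins [a]
   to [b]. *)
Definition gdist : nat :=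
  find (fun n => [exists p : n.-tuple G, gpath p]) (iota 0 #|G|).

Lemma gdist_le (p : seq G) : gpath p -> gdist <= size p.
Proof.
move=> abp; have /and3P[_ _ /card_uniqP /= Up] := abp.
have lt_pG : size p < #|G| by rewrite -Up max_card.
rewrite leqNgt; apply/negP=> /(before_find 0); rewrite nth_iota // add0n.
by move/existsP; apply; exists (in_tuple p).
Qed.

Lemma gdist_attained (p : seq G) :
  gpath p -> exists q : gdist.-tuple G, gpath q.
Proof.
move=> abp; have /and3P[_ _ /card_uniqP /= Up] := abp.
have lt_pG : size p < #|G| by rewrite -Up max_card.
have := leq_ltn_trans (gdist_le abp) lt_pG.
rewrite -[X in _ < X](size_iota 0) -has_find => /(nth_find 0).
rewrite nth_iota; first by rewrite add0n => /existsP.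
exact: leq_ltn_trans (gdist_le abp) lt_pG.
Qed.

Definition spath : finType := {p : gdist.-tuple G | gpath p}.

End ShortestPathGraph.

Definition ndiff (T : eqType) (n : nat) (u v : n.-tuple T) : nat :=
  #|[pred i | tnth u i != tnth v i]|.

Lemma ndiff_sym (T : eqType) (n : nat) (u v : n.-tuple T) :
  ndiff u v = ndiff v u.
Proof. by apply: eq_card => i; rewrite !inE eq_sym. Qed.

Lemma ndiff_refl (T : eqType) (n : nat) (u : n.-tuple T) : ndiff u u = 0.
Proof. by apply: eq_card0 => i; rewrite !inE eqxx. Qed.

(* Shortest [a, b]-paths are compared position by position; the omitted initial
   vertex [a] is common to all of them. *)
Definition spath_adj (G : sgraph) (a b : G) : rel (spath a b) :=
  fun p q => ndiff (val p) (val q) == 1.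

Lemma spath_adj_sym (G : sgraph) (a b : G) : symmetric (@spath_adj G a b).
Proof. by move=> p q; rewrite /spath_adj ndiff_sym. Qed.

Lemma spath_adj_irrefl (G : sgraph) (a b : G) :
  irreflexive (@spath_adj G a b).
Proof. by move=> p; rewrite /spath_adj ndiff_refl. Qed.

Definition spath_graph (G : sgraph) (a b : G) : sgraph :=
  SGraph (@spath_adj_sym G a b) (@spath_adj_irrefl G a b).

Definition cube_adj (m : nat) : rel (m.-tuple bool) :=
  fun x y => ndiff x y == 1.

Lemma cube_adj_sym m : symmetric (@cube_adj m).
Proof. by move=> x y; rewrite /cube_adj ndiff_sym. Qed.

Lemma cube_adj_irrefl m : irreflexive (@cube_adj m).
Proof. by move=> x; rewrite /cube_adj ndiff_refl. Qed.

Definition hypercube (m : nat) : sgraph :=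
  SGraph (@cube_adj_sym m) (@cube_adj_irrefl m).

Definition diametric (m : nat) (a b : hypercube m) : bool := gdist a b == m.

Section Cayley.

Local Open Scope group_scope.

Record connection_set (gT : finGroupType) := ConnectionSet {
  cset :> {set gT};
  cset_gen : <<cset>> = [set: gT];
  cset_non1 : 1 \notin cset;
  csetV : {in cset, forall s, s^-1 \in cset}
}.

Variables (gT : finGroupType) (S : connection_set gT).

Definition cayley_adj : rel gT :=
  fun x y => [exists s, (s \in (S : {set gT})) && (x * s == y)].

Lemma cayley_adj_sym : symmetric cayley_adj.
Proof.
suff imp x y : cayley_adj x y -> cayley_adj y x.
  by move=> x y; apply/idP/idP; apply: imp.
case/existsP=> s /andP[Ss /eqP <-]; apply/existsP; exists s^-1.
by rewrite csetV //= mulgK.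
Qed.

Lemma cayley_adj_irrefl : irreflexive cayley_adj.
Proof.
move=> x; apply/existsP=> -[s /andP[Ss /eqP xs]].
case/negP: (cset_non1 S); rewrite -(_ : s = 1) //.
by apply: (mulgI x); rewrite xs mulg1.
Qed.

Definition Cayley : sgraph := SGraph cayley_adj_sym cayley_adj_irrefl.

End Cayley.

(* The product of ['S_m] is [(s * t) x = t (s x)]; [Sym m] has the same
   elements and the product [(s * t) x = s (t x)], see [SymM]. *)
Definition Sym (m : nat) : Type := 'S_m.

Section SymGroup.

Local Open Scope group_scope.

Variable m : nat.

Definition sym_mul (s t : 'S_m) : 'S_m := t * s.

Lemma sym_mulA : associative sym_mul.
Proof. by move=> s t u; rewrite /sym_mul mulgA. Qed.

Lemma sym_mul1 : left_id 1 sym_mul.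
Proof. by move=> s; rewrite /sym_mul mulg1. Qed.

Lemma sym_mulV : left_inverse 1 (fun s : 'S_m => s^-1) sym_mul.
Proof. by move=> s; rewrite /sym_mul mulgV. Qed.

HB.instance Definition _ := Finite.on (Sym m).
HB.instance Definition _ :=
  Finite_isGroup.Build (Sym m) sym_mulA sym_mul1 sym_mulV.

Lemma SymM (s t : Sym m) (j : 'I_m) :
  ((s * t : Sym m) : 'S_m) j = (s : 'S_m) ((t : 'S_m) j).
Proof. exact: permM. Qed.

(* With positions [0, ..., m - 1], the transpositions exchanging [i] and
   [i + 1]. *)
Definition adj_transp : {set Sym m} :=
  [set s : Sym m |
    [exists i : 'I_m, exists j : 'I_m, (j == i.+1 :> nat) && (s == tperm i j)]].

Lemma adj_transpP (s : Sym m) :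
  reflect (exists i j : 'I_m, j = i.+1 :> nat /\ s = tperm i j)
          (s \in adj_transp).
Proof.
rewrite inE; apply: (iffP existsP) => [[i /existsP[j /andP[/eqP ij /eqP ->]]]|].
  by exists i, j.
case=> i [j [ij ->]]; exists i; apply/existsP; exists j.
by rewrite ij !eqxx.
Qed.

Lemma tperm_gen_adj (i j : 'I_m) :
  i < j -> (tperm i j : Sym m) \in <<adj_transp>>.
Proof.
have [k] := ubnP j; elim: k j => // k IHk j /ltnSE le_jk lt_ij.
have [ji|neq_ji] := eqVneq (j : nat) i.+1.
  by apply/mem_gen/adj_transpP; exists i, j.
have lt_ij1 : i < j.-1.
  case: (j : nat) lt_ij neq_ji => //= j'.
  by rewrite ltnS eqSS leq_eqVlt eq_sym => /predU1P[->|//]; rewrite eqxx.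
have j_gt0 : 0 < j by apply: leq_ltn_trans lt_ij.
have lt_j1m : j.-1 < m by rewrite prednK //; apply: ltnW.
pose h := Ordinal lt_j1m.
have hj : j = h.+1 :> nat by rewrite /= prednK.
have Gh : (tperm i h : Sym m) \in <<adj_transp>>.
  by apply: IHk => //=; rewrite prednK.
have Gt : (tperm h j : Sym m) \in <<adj_transp>>.
  by apply/mem_gen/adj_transpP; exists h, j.
have -> : (tperm i j : Sym m) = (tperm i h : Sym m) ^ (tperm h j : Sym m).
  rewrite /conjg.
  change (tperm i j = (tperm h j * tperm i h) * (tperm h j)^-1 :> 'S_m).
  rewrite -{1}[tperm h j]invgK -mulgA -[_ * (_ * _)]/(conjg _ _) tpermV tpermJ.
  rewrite tpermL tpermD //; apply/eqP=> /(congr1 val) /= e.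
    by rewrite e ltnn in lt_ij1.
  by rewrite e ltnn in lt_ij.
by rewrite groupJ.
Qed.

Lemma adj_transp_gen : <<adj_transp>> = [set: Sym m].
Proof.
apply/eqP; rewrite eqEsubset subsetT; apply/subsetP=> s _.
have [ts -> _] := prod_tpermP (s : 'S_m).
elim: ts => [|[i j] ts IHts]; first by rewrite big_nil; apply: group1.
rewrite big_cons /=; apply: (groupM IHts).
case: (ltngtP i j) => [|lt_ji|/val_inj ->]; first exact: tperm_gen_adj.
  by rewrite tpermC tperm_gen_adj.
by rewrite tperm1; apply: group1.
Qed.

Lemma adj_transp_non1 : 1 \notin adj_transp.
Proof.
apply/adj_transpP=> -[i [j [ij /(congr1 (fun s : 'S_m => s i))]]].
rewrite tpermL [X in X = _]perm1 => /(congr1 val) /= e.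
by move: ij; rewrite -e => /n_Sn.
Qed.

Lemma adj_transpV : {in adj_transp, forall s, s^-1 \in adj_transp}.
Proof.
move=> s /adj_transpP[i [j [ij ->]]]; apply/adj_transpP; exists i, j.
by split=> //; apply: tpermV.
Qed.

Definition adj_transp_cset : connection_set (Sym m) :=
  ConnectionSet adj_transp_gen adj_transp_non1 adj_transpV.

End SymGroup.

(* Main.v *)
(* From a vertex [a], a walk in the hypercube is the sequence of the positions
   it flips.  A walk from [a] to the diametric vertex [b] flips every position
   an odd number of times, so if it has length [m] this sequence is the word
   [s 0, ..., s (m - 1)] of a permutation [s].  The [k]-th vertex of the path
   only depends on the set of the first [k] letters of the word, so two paths
   differ in exactly one vertex iff their words are obtained from each other by
   swapping two consecutive letters, which is the right multiplication of [s]
   by an adjacent transposition. *)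
Require Import Defs.
From mathcomp Require Import all_boot all_fingroup.

Set Implicit Arguments.
Unset Strict Implicit.
Unset Printing Implicit Defensive.

(** * Hypercube walks as words of flipped positions *)

Section Flips.

Variable m : nat.
Implicit Types (x y : m.-tuple bool) (i j : 'I_m) (l : seq 'I_m).

Definition flip x i : m.-tuple bool := [tuple tnth x j (+) (j == i) | j < m].

Lemma tnth_foldl_flip x l j :
  tnth (foldl flip x l) j = tnth x j (+) odd (count_mem j l).
Proof.
elim: l x => [|i l IHl] x /=; first by rewrite addbF.
by rewrite IHl tnth_mktuple oddD oddb addbA eq_sym.
Qed.

Lemma tnth_foldl_flip_uniq x l j :
  uniq l -> tnth (foldl flip x l) j = tnth x j (+) (j \in l).
Proof. by move=> Ul; rewrite tnth_foldl_flip count_uniq_mem // oddb. Qed.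

Lemma cube_adjP x y : reflect (exists i, y = flip x i) (cube_adj x y).
Proof.
apply: (iffP idP) => [/eqP/mem_card1[i xyi]|[i ->]].
  exists i; apply: eq_from_tnth => j; rewrite tnth_mktuple.
  by have := xyi j; rewrite !inE => <-; case: (tnth x j); case: (tnth y j).
rewrite /cube_adj -(card1 i); apply/eqP/eq_card => j.
by rewrite !inE tnth_mktuple; case: (tnth x j); case: (j == i).
Qed.

Lemma path_flip x l : path (@cube_adj m) x (scanl flip x l).
Proof.
by elim: l x => //= i l IHl x; rewrite IHl andbT; apply/cube_adjP; exists i.
Qed.

Lemma last_scanl_flip x l : last x (scanl flip x l) = foldl flip x l.
Proof. by elim: l x => /=. Qed.

(** The first letter [i] never recurs, so every later vertex still differs from [x] at position
    [i]. *)
Lemma uniq_flip x l : uniq l -> uniq (x :: scanl flip x l).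
Proof.
elim: l x => [|i l IHl] x //= /andP[l'i Ul].
apply/andP; split; last exact: IHl.
rewrite -[_ :: _]/(scanl flip x (i :: l)); apply/negP => /(nthP x)[k].
rewrite size_scanl => lt_k; rewrite nth_scanl // => /(congr1 (fun y => tnth y i)).
rewrite tnth_foldl_flip_uniq ?take_uniq //= ?l'i // mem_head.
by case: (tnth x i).
Qed.

Lemma path_cubeP x (p : seq (m.-tuple bool)) :
  path (@cube_adj m) x p -> exists l, p = scanl flip x l.
Proof.
elim: p x => [|y p IHp] x /=; first by exists [::].
by case/andP=> /cube_adjP[i ->] /IHp[l ->]; exists (i :: l).
Qed.

Lemma scanl_flip_inj x : injective (scanl flip x).
Proof.
move=> l l'; elim: l x l' => [|i l IHl] x [|i' l'] // eq_s.
have eq_h : flip x i = flip x i' := congr1 (head x) eq_s.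
have <-: i = i'.
  have := congr1 (fun y => tnth y i) eq_h; rewrite !tnth_mktuple eqxx.
  by case: eqP => //; case: (tnth x i).
by have := congr1 behead eq_s; rewrite /= -eq_h => /IHl ->.
Qed.

(** Kept general in [a] and [b]: [diametric_tnth] applies it before they are known to differ
    everywhere. *)
Lemma flip_gpath (a b : hypercube m) l :
  uniq l -> (forall j, (j \in l) = (tnth a j != tnth b j)) ->
  gpath a b (scanl flip a l).
Proof.
move=> Ul lP; apply/and3P; split; [exact: path_flip | | exact: uniq_flip].
apply/eqP; rewrite last_scanl_flip; apply: eq_from_tnth => j.
by rewrite tnth_foldl_flip_uniq // lP; case: (tnth a j); case: (tnth b j).
Qed.

(** Flipping just the positions in [D] already joins [a] to [b], so the distance [m] is at most
    [#|D|] and [D] contains every position. *)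
Lemma diametric_tnth (a b : hypercube m) :
  diametric a b -> forall j, tnth a j != tnth b j.
Proof.
move=> /eqP ab_m j; pose D := [pred i | tnth a i != tnth b i].
have abD : gpath a b (scanl flip a (enum D)).
  by apply: flip_gpath (enum_uniq D) _ => i; rewrite mem_enum.
have := gdist_le abD; rewrite ab_m size_scanl -cardE.
apply: contraLR => D'j; rewrite -ltnNge -[ltnRHS]card_ord.
by apply/proper_card/properP; split; [apply/subsetP | exists j].
Qed.

End Flips.

(** * Adjacent transpositions recognized by initial segments *)

Section Permutations.

Variable m : nat.
Implicit Types s t u : 'S_m.

Lemma mem_take_codom s i k : (s i \in take k (codom s)) = (i < k).
Proof.
rewrite in_take ?codom_f // codomE index_map ?index_enum_ord //.
exact: perm_inj.
Qed.

(* [Defs.Sym] is qualified because perm.v has a notation [Sym]. *)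
Lemma adj_transp_card u :
  ((u : Defs.Sym m) \in adj_transp m) =
    (#|[pred k : 'I_m | [exists i, (u i <= k) != (i <= k)]]| == 1).
Proof.
(* An index [k] is counted when [u] does not preserve the initial segment of the [i <= k]. Swapping
   [i] and [i + 1] breaks only the segment ending at [i]. *)
apply/adj_transpP/idP => [[i [j [ij ->]]] | /eqP/mem_card1[k0 uk0]].
  rewrite -(card1 i); apply/eqP/eq_card => k; rewrite !inE.
  apply/existsP/eqP => [[h]|->]; last first.
    by exists i; rewrite tpermL leqnn ij ltnn.
  case: tpermP => [->|->|_ _]; last by rewrite eqxx.
    rewrite ij => ne; apply/val_inj/eqP.
    by move: ne; rewrite eqn_leq /=; case: ltngtP.
  rewrite ij => ne; apply/val_inj/eqP.
  by move: ne; rewrite eqn_leq /=; case: ltngtP.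
have leE k (i : 'I_m) : k != k0 :> nat -> k < m -> (u i <= k) = (i <= k).
  move=> k0'k lt_km; have := uk0 (Ordinal lt_km).
  rewrite !inE -val_eqE (negPf k0'k) => /negbT/existsPn/(_ i).
  by rewrite negbK => /eqP.
have ltE k (i : 'I_m) : k != k0.+1 -> k <= m -> (u i < k) = (i < k).
  by case: k => // k; rewrite eqSS; apply: leE.
(* For such an [i], the segments of indices [< i] and [<= i] are both preserved, so [u i = i]. *)
have fixE (i : 'I_m) : i != k0 :> nat -> i != k0.+1 :> nat -> u i = i.
  move=> k0'i k1'i; apply/val_inj/eqP; rewrite eqn_leq leE //= leqnn.
  by rewrite leqNgt ltE ?ltnn // ltnW.
have u_neq1 : u != 1%g.
  apply/eqP=> u1; have := uk0 k0; rewrite !inE eqxx => /existsP[i].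
  by rewrite u1 perm1 eqxx.
(* If [k0] were the last index, its segment would be all of ['I_m], which is trivially preserved. *)
have lt_k1m : k0.+1 < m.
  rewrite ltn_neqAle ltn_ord andbT; apply: contraNneq u_neq1 => k1m.
  have := uk0 k0; rewrite !inE eqxx => /existsP[i].
  by rewrite -!(ltnS _ k0) k1m !ltn_ord.
pose k1 := Ordinal lt_k1m; exists k0, k1; split=> //.
(* [u] preserves the indices below [k0] and those up to [k1], hence the pair of [k0] and [k1], which
   it must exchange since [u] is not 1. *)
have ge_k0 (i : 'I_m) : k0 <= i -> k0 <= u i.
  by rewrite 2!(leqNgt k0) ltE ?(ltnW (ltn_ord _)) // neq_ltn leqnn.
have le_k1 (i : 'I_m) : i <= k1 -> u i <= k1 by rewrite leE // neq_ltn leqnn orbT.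
have uk (i : 'I_m) : k0 <= i <= k1 -> u i = k0 \/ u i = k1.
  move=> /andP[/ge_k0 le0 /le_k1]; rewrite leq_eqVlt ltnS => /predU1P[e|le1].
    by right; apply: val_inj.
  by left; apply/val_inj/eqP; rewrite eqn_leq le1.
have ne01 : k0 <> k1 by move/(congr1 val)/n_Sn.
have u0 : u k0 = k1.
  case: (uk k0) => //; first by rewrite leqnn /= leqW.
  move=> u0; case/eqP: u_neq1; apply/permP=> i; rewrite perm1.
  have [/eqP/val_inj-> //|ne0] := boolP (i == k0 :> nat).
  have [/eqP i1|] := boolP (i == k0.+1 :> nat); last exact: fixE.
  have ->: i = k1 by apply: val_inj.
  case: (uk k1) => //; first by rewrite leqnn /= leqnSn.
  by rewrite -{1}u0 => /perm_inj/esym.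
have u1 : u k1 = k0.
  case: (uk k1) => //; first by rewrite leqnn /= leqnSn.
  by rewrite -{2}u0 => /perm_inj/esym.
apply/permP=> i; case: tpermP => [-> // | -> // | ne0 ne1].
by apply: fixE; apply/eqP => e; [case: ne0 | case: ne1]; apply: val_inj.
Qed.

(* In ['S_m] the product is reversed: this is [s^-1 * t] in [Defs.Sym m]. *)
Lemma cayley_adj_transpE (s t : Defs.Sym m) :
  cayley_adj (adj_transp_cset m) s t =
    ((((t : 'S_m) * (s : 'S_m)^-1)%g : Defs.Sym m) \in adj_transp m).
Proof.
rewrite -[((t : 'S_m) * _)%g]/((s : Defs.Sym m)^-1 * t : Defs.Sym m)%g.
apply/existsP/idP => [[r /andP[Tr /eqP <-]] | Tst]; first by rewrite mulKg.
by exists (s^-1 * t)%g; rewrite Tst mulKVg eqxx.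
Qed.

End Permutations.

(** The length [gdist a b] of a path equals [m] only through a proof, while its vertices have to be
    indexed by ['I_m]. *)
Lemma ndiff_cast (T : eqType) (n m : nat) (e : n = m) (u v : n.-tuple T) :
  ndiff u v = ndiff (tcast e u) (tcast e v).
Proof. by case: m / e. Qed.

(** * The bijection from permutations to shortest paths *)

Section PathOfPerm.

Variables (m : nat) (a b : hypercube m) (hab : diametric a b).

Lemma perm_path_size (s : 'S_m) :
  size (scanl (@flip m) a (codom s)) == gdist a b.
Proof. by rewrite size_scanl size_codom card_ord eq_sym. Qed.

Lemma perm_path_gpath (s : 'S_m) : gpath a b (Tuple (perm_path_size s)).
Proof.
apply: flip_gpath => [|j]; first by apply/injectiveP/perm_inj.
by rewrite diametric_tnth // -[j](permKV s) codom_f.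
Qed.

Definition perm_path (s : Cayley (adj_transp_cset m)) : spath_graph a b :=
  exist _ (Tuple (perm_path_size s)) (perm_path_gpath s).

Lemma perm_path_inj : injective perm_path.
Proof.
move=> s t /(congr1 (fun p => val (val p))) /= /scanl_flip_inj eq_st.
suff: (s : 'S_m) = (t : 'S_m) by [].
by apply/permP=> i; move/eq_in_map: eq_st => ->; rewrite ?mem_enum.
Qed.

Lemma perm_path_surj (p : spath_graph a b) : exists s, perm_path s == p.
Proof.
case: p => p abp; have /and3P[/path_cubeP[l def_p] /eqP last_p _] := abp.
have size_l : size l = m.
  by rewrite -(size_scanl (@flip m) a) -def_p size_tuple (eqP hab).
have in_l j : j \in l.
  have := diametric_tnth hab j; rewrite -last_p def_p last_scanl_flip.
  rewrite tnth_foldl_flip -has_pred1 has_count.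
  by case: (count_mem j l) => //=; rewrite addbF eqxx.
(* Pigeonhole: [m] letters covering all [m] positions leave no room for a repetition. *)
have Ul : uniq l.
  apply: (leq_size_uniq (enum_uniq 'I_m)) => [j _ //|].
  by rewrite size_enum_ord size_l.
have s_inj : injective (tnth (Tuple (introT eqP size_l))).
  by apply/tuple_uniqP.
exists (perm s_inj); apply/eqP/val_inj/val_inj; rewrite /= def_p.
congr (scanl _ _ _); rewrite codomE (eq_map (permE s_inj)).
by rewrite map_tnth_enum.
Qed.

(** The bound is [i <= k], not [i < k]: the tuple omits [a], so its entry [k] is reached after
    [k + 1] flips. *)
Lemma perm_path_tnth (s : Cayley (adj_transp_cset m)) (k i : 'I_m) :
  tnth (tnth (tcast (eqP hab) (val (perm_path s))) k) ((s : 'S_m) i) =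
    tnth a ((s : 'S_m) i) (+) (i <= k).
Proof.
rewrite tcastE (tnth_nth a) /= nth_scanl ?size_codom ?card_ord //.
rewrite tnth_foldl_flip_uniq ?mem_take_codom //.
by apply/take_uniq/injectiveP/perm_inj.
Qed.

(** At position [t i] the [k]-th vertices differ iff exactly one of [u i <= k] and [i <= k] holds,
    where [u] maps [i] to [s^-1 (t i)]. The differing vertices are thus those counted in
    [adj_transp_card]. *)
Lemma perm_path_adj (s t : Cayley (adj_transp_cset m)) :
  spath_adj (perm_path s) (perm_path t) = edge s t.
Proof.
rewrite [RHS]cayley_adj_transpE adj_transp_card.
rewrite /spath_adj (ndiff_cast (eqP hab)); congr (_ == 1).
apply: eq_card => k; rewrite !inE.
have tnthE (i : 'I_m) :
    tnth (tnth (tcast (eqP hab) (val (perm_path s))) k) ((t : 'S_m) i) =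
      tnth a ((t : 'S_m) i) (+) (((t : 'S_m) * (s : 'S_m)^-1)%g i <= k).
  by rewrite -[X in tnth _ X](permKV (s : 'S_m)) perm_path_tnth permKV permM.
apply/idP/existsP => [ne_st|[i]]; last first.
  apply: contraNneq => /(congr1 (fun x => tnth x ((t : 'S_m) i))).
  by rewrite tnthE perm_path_tnth => /addbI ->.
apply/existsP; apply: contraR ne_st => /existsPn eq_st.
apply/eqP/eq_from_tnth => j; have := eq_st (((t : 'S_m)^-1)%g j).
rewrite -[j in LHS](permKV (t : 'S_m)) -[j in RHS](permKV (t : 'S_m)).
by rewrite tnthE perm_path_tnth negbK => /eqP ->.
Qed.

End PathOfPerm.

Theorem proposition27 (m : nat) (hm : 1 <= m) (a b : hypercube m)
    (hab : diametric a b) :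
  isomorphic (spath_graph a b) (Cayley (adj_transp_cset m)).
Proof.
(* The isomorphism goes from paths to permutations, so it is the inverse of [perm_path]. *)
pose f p := xchoose (perm_path_surj hab p).
have fK : cancel f (perm_path hab).
  by move=> p; apply/eqP/(xchooseP (perm_path_surj hab p)).
exists f => [|p q].
  exists (perm_path hab) => //.
  exact: inj_can_sym fK (@perm_path_inj _ _ _ hab).
by rewrite -[in RHS](fK p) -[in RHS](fK q) [RHS]perm_path_adj.
Qed.
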